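(* The global flux quadrature divergence operator $$\mathrm{DIV}\,\mathbf v=(D_x\otimes D_yI_y)u+(D_xI_x\otimes D_y)v$$ vanishes identically whenever, for every cell $E=E_{ij}$ and all $s,p\in\{0,\dots,K\}$, the integrated divergence on the subcell $[x_{i,0},x_{i,s}]\times[y_{j,0},y_{j,p}]$ vanishes: $$\Phi^E_{i,s;j,p}=0\ \ \forall s,p \text{ and } \forall E_{ij}\ \Longrightarrow\ \mathrm{DIV}\,\mathbf v=0.$$
   Context: Grid and spaces: $K\ge1$; $\Omega^x=\bigcup_{i=0}^{N_x-1}E^x_i$ with $E_i^x=[x_i,x_{i+1}]$ of equal length $\Delta x$, $\Omega^y=\bigcup_{j=0}^{N_y-1}E^y_j$ with $E_j^y=[y_j,y_{j+1}]$ of equal length $\Delta y$; $E_{ij}=E^x_i\times E^y_j$. With the Gauss–Lobatto points $0=\xi_0<\dots<\xi_K=1$ of $[0,1]$, set $x_{i,p}=x_i+\xi_p\Delta x$, $y_{j,p}=y_j+\xi_p\Delta y$ (so $x_{i,K}=x_{i+1,0}$), numbered globally as $x_\alpha=x_{i,p}$, $\alpha=iK+p$, $0\le\alpha\le N_xK$, and similarly $y_\beta$. A grid function $q=(q_{\alpha;\beta})$ is identified with $q_h=\sum q_{\alpha;\beta}\varphi^x_\alpha(x)\varphi^y_\beta(y)$, where $\varphi^x_\alpha$ is continuous, of degree $\le K$ on each cell, with $\varphi^x_\alpha(x_{\alpha'})=\delta_{\alpha\alpha'}$ (same in $y$). Operators: $(D_x)_{\alpha\alpha'}=\int_{\Omega^x}\varphi^x_\alpha\partial_x\varphi^x_{\alpha'}dx$,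 $D_y$ likewise; $((A\otimes B)q)_{\alpha;\beta}=\sum_{\alpha',\beta'}A_{\alpha\alpha'}B_{\beta\beta'}q_{\alpha';\beta'}$; the integrator is $(I_xw)_\alpha=\int_{x_0}^{x_\alpha}w_h\,dx$ with $w_h=\sum_{\alpha'} w_{\alpha'}\varphi^x_{\alpha'}$, similarly $I_y$. For grid functions $u,v$ the integrated divergence on subcells of $E=E_{ij}$ is $$\Phi^E_{i,s;j,p}=\int_{y_{j,0}}^{y_{j,p}}\big(u_h(x_{i,s},y)-u_h(x_{i,0},y)\big)dy+\int_{x_{i,0}}^{x_{i,s}}\big(v_h(x,y_{j,p})-v_h(x,y_{j,0})\big)dx.$$ *)

(* Defs.v *)
From mathcomp Require Import all_boot all_order all_algebra.
From mathcomp Require Import all_classical all_reals all_analysis.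

Set Implicit Arguments.
Unset Strict Implicit.
Unset Printing Implicit Defensive.

Import Order.TTheory GRing.Theory Num.Theory.
Import numFieldNormedType.Exports.

Local Open Scope classical_set_scope.
Local Open Scope ring_scope.

(* Legendre polynomial of degree n shifted to [0, 1], by Rodrigues' formula
   (p^`N(n) is the n-th derivative divided by n!). *)
Definition shifted_legendre (R : realType) (n : nat) : {poly R} :=
  (('X ^+ 2 - 'X) ^+ n)^`N(n).

(* The K - 1 interior Gauss-Lobatto points are the roots of P_K'. *)
Definition gauss_lobatto (R : realType) (K : nat) (xi : 'I_K.+1 -> R) : Prop :=
  [/\ xi ord0 = 0, xi ord_max = 1,
      forall p q : 'I_K.+1, (p < q)%N -> xi p < xi q
    & forall p : 'I_K.+1, (0 < p < K)%N ->
        root (shifted_legendre R K)^`() (xi p)].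

(* One-dimensional grid with origin o = x_0 and cell length h. *)
Definition gridpt (R : realType) (o h : R) (i : nat) : R := o + i%:R * h.

Definition cell (R : realType) (o h : R) (i : nat) : set R :=
  `[gridpt o h i, gridpt o h i.+1].

Definition domain (R : realType) (N : nat) (o h : R) : set R :=
  \bigcup_(i < N) cell o h i.

(* x_{i,p} *)
Definition cellpt (R : realType) (K : nat) (o h : R) (xi : 'I_K.+1 -> R)
  (i : nat) (p : 'I_K.+1) : R := gridpt o h i + xi p * h.

(* x_alpha = x_{i,p} for alpha = i K + p.  Euclidean division picks p < K; the
   other representation, p = K, gives the same point as x_{i,K} = x_{i+1,0}. *)
Definition globpt (R : realType) (K : nat) (o h : R) (xi : 'I_K.+1 -> R)
  (a : nat) : R := cellpt o h xi (a %/ K) (inord (a %% K)).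

(* The nodal basis is constrained only on the domain; its values elsewhere are
   never used by the operators below. *)
Definition nodal_basis (R : realType) (K N : nat) (o h : R)
  (xi : 'I_K.+1 -> R) (phi : 'I_(N * K).+1 -> R -> R) : Prop :=
  forall a : 'I_(N * K).+1,
  [/\ {within domain N o h, continuous (phi a)},
      forall i : 'I_N, exists2 P : {poly R}, (size P <= K.+1)%N
        & forall x, cell o h i x -> phi a x = P.[x]
    & forall b : 'I_(N * K).+1, phi a (globpt o h xi b) = (a == b)%:R].

Definition interp (R : realType) (n : nat) (phi : 'I_n -> R -> R)
  (w : 'cV[R]_n) (x : R) : R := \sum_(a < n) w a 0 * phi a x.

Definition interp2 (R : realType) (m n : nat) (phix : 'I_m -> R -> R)
  (phiy : 'I_n -> R -> R) (q : 'M[R]_(m, n)) (x y : R) : R :=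
  \sum_(a < m) \sum_(b < n) q a b * phix a x * phiy b y.

(* The derivative derive1 (phi b) is only meaningful off the cell boundaries, which
   form a Lebesgue-null set. *)
Definition diff_mx (R : realType) (K N : nat) (o h : R)
  (phi : 'I_(N * K).+1 -> R -> R) : 'M[R]_((N * K).+1) :=
  \matrix_(a, b) (\int[lebesgue_measure]_(x in domain N o h)
                    (phi a x * derive1 (phi b) x))%R.

Definition integrator (R : realType) (K N : nat) (o h : R)
  (xi : 'I_K.+1 -> R) (phi : 'I_(N * K).+1 -> R -> R)
  (w : 'cV[R]_((N * K).+1)) : 'cV[R]_((N * K).+1) :=
  \col_a (\int[lebesgue_measure]_(x in `[gridpt o h 0, globpt o h xi a])
            interp phi w x)%R.

(* The matrix of the linear map [integrator] in the canonical basis. *)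
Definition integrator_mx (R : realType) (K N : nat) (o h : R)
  (xi : 'I_K.+1 -> R) (phi : 'I_(N * K).+1 -> R -> R) : 'M[R]_((N * K).+1) :=
  \matrix_(a, b) integrator o h xi phi (delta_mx b 0) a 0.

Definition tensor_app (R : realType) (m n : nat) (A : 'M[R]_m) (B : 'M[R]_n)
  (q : 'M[R]_(m, n)) : 'M[R]_(m, n) :=
  \matrix_(a, b) \sum_(a' < m) \sum_(b' < n) A a a' * B b b' * q a' b'.

Definition subcell_div (R : realType) (K Nx Ny : nat) (x0 y0 dx dy : R)
  (xi : 'I_K.+1 -> R)
  (phix : 'I_(Nx * K).+1 -> R -> R) (phiy : 'I_(Ny * K).+1 -> R -> R)
  (u v : 'M[R]_((Nx * K).+1, (Ny * K).+1))
  (i : 'I_Nx) (s : 'I_K.+1) (j : 'I_Ny) (p : 'I_K.+1) : R :=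
  let X := cellpt x0 dx xi i in
  let Y := cellpt y0 dy xi j in
  let uh := interp2 phix phiy u in
  let vh := interp2 phix phiy v in
  (\int[lebesgue_measure]_(y in `[Y ord0, Y p])
      (uh (X s) y - uh (X ord0) y))%R
  + (\int[lebesgue_measure]_(x in `[X ord0, X s])
      (vh x (Y p) - vh x (Y ord0)))%R.

Definition gf_div (R : realType) (K Nx Ny : nat) (x0 y0 dx dy : R)
  (xi : 'I_K.+1 -> R)
  (phix : 'I_(Nx * K).+1 -> R -> R) (phiy : 'I_(Ny * K).+1 -> R -> R)
  (u v : 'M[R]_((Nx * K).+1, (Ny * K).+1)) :
  'M[R]_((Nx * K).+1, (Ny * K).+1) :=
  let Dx := diff_mx x0 dx phix in
  let Dy := diff_mx y0 dy phiy in
  let Ix := integrator_mx x0 dx xi phix in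
  let Iy := integrator_mx y0 dy xi phiy in
  tensor_app Dx (Dy *m Iy) u + tensor_app (Dx *m Ix) Dy v.

(* Main.v *)
Require Import Defs.
From mathcomp Require Import all_boot all_order all_algebra.
From mathcomp Require Import all_classical all_reals all_analysis.
From mathcomp Require Import measurable_realfun ring.

Set Implicit Arguments.
Unset Strict Implicit.
Unset Printing Implicit Defensive.

Import Order.TTheory GRing.Theory Num.Theory.
Import numFieldNormedType.Exports.

Local Open Scope ring_scope.

(** The matrices acting on grid functions factor as
      [DIV = Dx * W * Dy^T], where [W = u * Iy^T + Ix * v]
    is the primitive flux: the [y]-primitive of [u] plus the [x]-primitive of
    [v], sampled at the grid nodes ([gf_div_global_flux]).

    By additivity of the integral, the integrated divergence on a subcell is the
    mixed second difference of [W] over the four corners of that subcell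
    ([subcell_div_global_flux]); here the nodal property turns the trace of the
    two-dimensional interpolant on a grid line into the one-dimensional
    interpolant of a row or column of nodal values.  If all these differences
    vanish, then, since consecutive cells share a node, they chain together over
    the whole grid, and [W] splits as a function of [x] plus a function of [y]
    ([mixed_diff_split]).

    Finally [Dx] and [Dy] annihilate constants ([diff_mx_row_sum]): the basis
    functions sum to 1 on each cell, because a polynomial of degree at most [K]
    equal to 1 at [K + 1] points is 1, and so their derivatives sum to 0 away
    from the cell boundaries.  A split [W] is therefore killed by [Dx] on one
    side or by [Dy] on the other ([mul_split_mx0]).

    The analytic work lies in the linearity of the integrals defining [Dx]: the
    integrands are uncontrolled at the cell boundaries, where the basis
    functions have kinks, and integrability has to be obtained in spite of those
    finitely many points. *)

(** * Node numbering and separation of variables *)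

(** The same global node has two local names, [(i, K)] and [(i + 1, 0)]: unlike
    the division in [globpt], the local name here is free to be either one.
    Outside the grid, [inord] returns the default index 0. *)
Definition node_index (N K i : nat) (s : 'I_K.+1) : 'I_(N * K).+1 :=
  inord (i * K + s).

Lemma node_indexE (N K i : nat) (s : 'I_K.+1) : (i < N)%N ->
  node_index N i s = (i * K + s)%N :> nat.
Proof.
move=> iN; rewrite /node_index inordK// ltnS (@leq_trans (i.+1 * K))//.
  by rewrite mulSn addnC leq_add2r -ltnS.
by rewrite leq_mul2r iN orbT.
Qed.

Lemma node_index_surj (N K : nat) (a : 'I_(N * K).+1) :
  (0 < N)%N -> (0 < K)%N ->
  exists i (s : 'I_K.+1), (i < N)%N /\ a = node_index N i s.
Proof.
move=> N0 K0; have [aNK|NKa] := ltnP a (N * K)%N.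
- have iN : (a %/ K < N)%N by rewrite ltn_divLR.
  exists (a %/ K)%N, (inord (a %% K)); split => //.
  apply: ord_inj; rewrite node_indexE// inordK; first exact: divn_eq.
  by rewrite ltnS ltnW// ltn_mod.
(* The last node of the grid is only reachable as the end of a cell. *)
- exists N.-1, ord_max; rewrite ltn_predL; split => //.
  have NE : (N.-1 * K + K = N * K)%N by rewrite addnC -mulSn prednK.
  apply: ord_inj; rewrite node_indexE ?ltn_predL//= NE; apply/eqP.
  by rewrite eqn_leq -ltnS ltn_ord NKa.
Qed.

(** The last node of a cell is the first node of the next one, so constancy on
    each cell propagates through the grid. *)
Lemma cell_constant (T : Type) (N K : nat) (F : 'I_(N * K).+1 -> T) :
  (0 < N)%N -> (0 < K)%N ->
  (forall i (s : 'I_K.+1), (i < N)%N ->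
     F (node_index N i s) = F (node_index N i ord0)) ->
  forall a, F a = F ord0.
Proof.
move=> N0 K0 FC a; have [i [s [iN ->]]] := node_index_surj a N0 K0.
rewrite FC//; elim: i iN {s} => [|i IH] iN.
  by congr F; apply: ord_inj; rewrite node_indexE.
rewrite -IH ?(ltnW iN)// -(FC i ord_max (ltnW iN)); congr F.
by apply: ord_inj; rewrite !node_indexE ?(ltnW iN)//= mulSn addn0 addnC.
Qed.

(** The hypothesis concerns only rectangles anchored at the corner of a cell.
    Applying [cell_constant] in one index, then in the other, extends it to all
    rectangles anchored at the origin of the grid. *)
Lemma mixed_diff_split (V : zmodType) (Nx Ny K : nat)
  (W : 'I_(Nx * K).+1 -> 'I_(Ny * K).+1 -> V) :
  (0 < Nx)%N -> (0 < Ny)%N -> (0 < K)%N ->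
  (forall i j (s p : 'I_K.+1), (i < Nx)%N -> (j < Ny)%N ->
    W (node_index Nx i s) (node_index Ny j p) -
    W (node_index Nx i s) (node_index Ny j ord0) =
    W (node_index Nx i ord0) (node_index Ny j p) -
    W (node_index Nx i ord0) (node_index Ny j ord0)) ->
  forall a b, W a b = (W a ord0 - W ord0 ord0) + W ord0 b.
Proof.
move=> Nx0 Ny0 K0 H a b.
have Hj j p a' : (j < Ny)%N ->
    W a' (node_index Ny j p) - W a' (node_index Ny j ord0) =
    W ord0 (node_index Ny j p) - W ord0 (node_index Ny j ord0).
  move=> jN.
  apply: (cell_constant
    (F := fun c => W c (node_index Ny j p) - W c (node_index Ny j ord0)))
    => // i s iN.
  exact: H.
rewrite -(cell_constant (F := fun c => W a c - W ord0 c) Ny0 K0 _ b) ?subrK//.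
move=> j p jN; have /eqP := Hj j p a jN; rewrite subr_eq => /eqP ->.
by rewrite addrAC [_ - _ - _]addrAC subrr add0r addrC.
Qed.

Lemma tensor_appE (R : realType) (m n : nat) (A : 'M[R]_m) (B : 'M[R]_n)
  (q : 'M[R]_(m, n)) : tensor_app A B q = A *m q *m B^T.
Proof.
apply/matrixP => a b; rewrite !mxE.
under [RHS]eq_bigr do rewrite !mxE mulr_suml.
rewrite exchange_big; apply: eq_bigr => a' _; apply: eq_bigr => b' _.
by rewrite mulrAC.
Qed.

(** [A] kills the part of [W] that depends on the column index only, and [B^T]
    the part that depends on the row index only. *)
Lemma mul_split_mx0 (R : pzRingType) (m n : nat) (A : 'M[R]_m) (B : 'M[R]_n)
  (W : 'M[R]_(m, n)) (f : 'I_m -> R) (g : 'I_n -> R) :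
  (forall a, \sum_b A a b = 0) -> (forall a, \sum_b B a b = 0) ->
  (forall a b, W a b = f a + g b) -> A *m W *m B^T = 0.
Proof.
move=> A0 B0 WE; have -> : W = (\matrix_(a, b) f a) + (\matrix_(a, b) g b).
  by apply/matrixP => a b; rewrite !mxE.
rewrite mulmxDr mulmxDl -mulmxA.
have -> : (\matrix_(a < m, b < n) f a) *m B^T = 0.
  apply/matrixP => a b; rewrite !mxE.
  by under eq_bigr do rewrite !mxE; rewrite -mulr_sumr B0 mulr0.
have -> : A *m (\matrix_(a < m, b < n) g b) = 0.
  apply/matrixP => a b; rewrite !mxE.
  by under eq_bigr do rewrite !mxE; rewrite -mulr_suml A0 mul0r.
by rewrite mulmx0 mul0mx addr0.
Qed.

(** * Integrals over the grid *)

Lemma gridpt_le (R : realType) (o h : R) (i j : nat) : 0 < h -> (i <= j)%N ->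
  gridpt o h i <= gridpt o h j.
Proof. by move=> h0 ij; rewrite lerD2l ler_pM2r// ler_nat. Qed.

Lemma domainE (R : realType) (N : nat) (o h : R) : 0 < h -> (0 < N)%N ->
  domain N o h = `[gridpt o h 0, gridpt o h N]%classic.
Proof.
move=> h0 N0; apply/seteqP; split => x.
  move=> [i /= iN]; rewrite /cell /= !in_itv/= => /andP[ix xi].
  by rewrite (le_trans _ ix) ?gridpt_le// (le_trans xi)// gridpt_le.
rewrite /= in_itv/= => /andP[x0 xN].
suff : exists2 i, (i < N)%N & cell o h i x by move=> [i]; exists i.
elim: N N0 xN => // -[_ _ x1|N IH _ xN].
  by exists 0%N; rewrite //= /cell/= in_itv/= x0.
have [xN1|Nx] := leP x (gridpt o h N.+1).
  by have [//|i iN ix] := IH _ xN1; exists i => //; rewrite ltnW.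
by exists N.+1; rewrite //= /cell/= in_itv/= (ltW Nx).
Qed.

(** Integrability with no control on [f] at the cell boundaries.  Measurability
    is checked on the interior of each cell and on single points; as dominating
    function one can take the sum of all [`|Q k|], which is continuous on the
    compact domain, plus the constant [M] that absorbs the finitely many
    boundary values. *)
Lemma integrable_piecewise_poly (R : realType) (N : nat) (o h : R) (f : R -> R)
  (Q : nat -> {poly R}) : 0 < h -> (0 < N)%N ->
  (forall i x, (i < N)%N -> gridpt o h i < x < gridpt o h i.+1 ->
     f x = (Q i).[x]) ->
  lebesgue_measure.-integrable (domain N o h) (EFin \o f).
Proof.
move=> h0 N0 fQ.
pose M := \sum_(k < N.+1) `|f (gridpt o h k)|.
have cM : continuous (fun x => \sum_(k < N) `|(Q k).[x]| + M).
  move=> x; apply: cvgD; last exact: cvg_cst.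
  apply: cvg_big => [|k _]; first exact: add_continuous.
  by apply: cvg_norm; exact: continuous_horner.
have mc i : measurable (cell o h i) by exact: measurable_itv.
have open_or x i : cell o h i x ->
    gridpt o h i < x < gridpt o h i.+1 \/
    x = gridpt o h i \/ x = gridpt o h i.+1.
  rewrite /cell /= in_itv/= => /andP[ix xi].
  have [|xNi] := eqVneq x (gridpt o h i); first by right; left.
  have [|xNi1] := eqVneq x (gridpt o h i.+1); first by right; right.
  by left; rewrite !lt_neqAle eq_sym xNi ix xNi1 xi.
have mf : measurable_fun (domain N o h) f.
  rewrite /domain bigcup_mkcond; apply/measurable_fun_bigcup => i.
    by case: ifP.
  case: ifPn => [|_]; last exact: measurable_fun_set0.
  rewrite inE /= => iN.
  have -> : cell o h i = (`]gridpt o h i, gridpt o h i.+1[ `|`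
      ([set gridpt o h i] `|` [set gridpt o h i.+1]))%classic.
    apply/seteqP; split => x /=; first by rewrite in_itv/=; exact: open_or.
    rewrite /cell/= !in_itv/=.
    have := @gridpt_le _ o h i i.+1 h0 (leqnSn _).
    by move=> ii [/andP[/ltW-> /ltW->]|[->|->]]; rewrite ?lexx ?ii.
  apply/measurable_funU => //; first exact: measurableU.
  split; last by apply/measurable_funU => //; split; exact: measurable_fun_set1.
  apply: (@eq_measurable_fun _ _ _ _ _ (horner (Q i))).
    by move=> x; rewrite inE/= in_itv/= => xi; rewrite (fQ i).
  exact: pi_irrational.measurable_poly.
have mD : measurable (domain N o h) by rewrite domainE.
have iM : lebesgue_measure.-integrable (domain N o h)
    (EFin \o (fun x => \sum_(k < N) `|(Q k).[x]| + M)).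
  rewrite domainE//; apply: continuous_compact_integrable.
    exact: segment_compact.
  exact: continuous_subspaceT.
apply: (le_integrable _ _ _ iM); first exact: mD.
  exact/measurable_EFinP.
move=> x [i /= iN ix]; rewrite lee_fin.
rewrite [leRHS]ger0_norm; last by rewrite addr_ge0// sumr_ge0.
case: (open_or _ _ ix) => [xi|].
  rewrite (fQ i)// (bigD1 (Ordinal iN))//= -addrA lerDl.
  by rewrite addr_ge0// ?sumr_ge0.
have s0 : 0 <= \sum_(k < N) `|(Q k).[x]| by rewrite sumr_ge0.
move=> xE; apply: ler_wpDl => //; rewrite /M.
have iN1 : (i < N.+1)%N by rewrite ltnW.
case: xE => ->.
  by rewrite (bigD1 (Ordinal iN1))//= lerDl sumr_ge0.
by rewrite (bigD1 (@Ordinal N.+1 i.+1 iN))//= lerDl sumr_ge0.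
Qed.

(** The cell boundaries form a Lebesgue-null set. *)
Lemma Rintegral_zero_off_grid (R : realType) (N : nat) (o h : R) (f : R -> R) :
  0 < h -> (0 < N)%N ->
  (forall i x, (i < N)%N -> gridpt o h i < x < gridpt o h i.+1 -> f x = 0) ->
  (\int[lebesgue_measure]_(x in domain N o h) f x)%R = 0.
Proof.
move=> h0 N0 f0; pose S := range (gridpt o h).
have cS : countable S.
  exact: card_le_trans (card_image_le _ _) (countableP _).
have mS : measurable S by exact: countable_measurable.
have mD : measurable (domain N o h) by rewrite domainE.
rewrite /Rintegral.
rewrite (@negligible_integral _ _ _ lebesgue_measure _ S (EFin \o f))//.
- rewrite integral0_eq// => x [[i /= iN]].
  rewrite /cell/= in_itv/= => ix nS; congr EFin; apply: (f0 i) => //.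
  rewrite !lt_neqAle; case/andP: ix => -> ->; rewrite !andbT.
  by apply/andP; split; apply/eqP => E; apply: nS; [exists i|exists i.+1].
- apply: (@integrable_piecewise_poly _ _ _ _ _ (fun=> 0)) => // i x iN xi.
  by rewrite horner0 (f0 i).
- exact: countable_lebesgue_measure0.
Qed.

Lemma Rintegral_sum (d : measure_display) (T : measurableType d) (R : realType)
  (mu : {measure set T -> \bar R}) (D : set T) (n : nat) (f : 'I_n -> T -> R) :
  measurable D -> (forall i, mu.-integrable D (EFin \o f i)) ->
  (\int[mu]_(x in D) (\sum_i f i x))%R = \sum_i (\int[mu]_(x in D) f i x)%R.
Proof.
move=> mD fi; rewrite /Rintegral sum_fine; last first.
  by move=> i _; apply: (integrable_fin_num mD (fi i)).
congr fine; rewrite -(integral_sum mD fi).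
by apply: eq_integral => x _; rewrite /= sumEFin.
Qed.

(** * The nodal basis *)

Lemma cellpt0 (R : realType) (K : nat) (o h : R) (xi : 'I_K.+1 -> R) (i : nat) :
  gauss_lobatto xi -> cellpt o h xi i ord0 = gridpt o h i.
Proof. by case=> x0 _ _ _; rewrite /cellpt x0 mul0r addr0. Qed.

Lemma cellpt_max (R : realType) (K : nat) (o h : R) (xi : 'I_K.+1 -> R) (i : nat) :
  gauss_lobatto xi -> cellpt o h xi i ord_max = gridpt o h i.+1.
Proof.
by case=> _ x1 _ _; rewrite /cellpt x1 /gridpt -addrA -mulrDl natr1.
Qed.

Lemma cellpt_lt (R : realType) (K : nat) (o h : R) (xi : 'I_K.+1 -> R) (i : nat)
  (p q : 'I_K.+1) : gauss_lobatto xi -> 0 < h -> (p < q)%N ->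
  cellpt o h xi i p < cellpt o h xi i q.
Proof. by case=> _ _ lt _ h0 pq; rewrite /cellpt ltrD2l ltr_pM2r// lt. Qed.

Lemma cellpt_le (R : realType) (K : nat) (o h : R) (xi : 'I_K.+1 -> R) (i : nat)
  (p q : 'I_K.+1) : gauss_lobatto xi -> 0 < h -> (p <= q)%N ->
  cellpt o h xi i p <= cellpt o h xi i q.
Proof.
move=> gl h0; rewrite leq_eqVlt => /orP[/eqP/ord_inj ->//|pq].
exact/ltW/cellpt_lt.
Qed.

Lemma cellpt_in_cell (R : realType) (K : nat) (o h : R) (xi : 'I_K.+1 -> R)
  (i : nat) (p : 'I_K.+1) : gauss_lobatto xi -> 0 < h ->
  cell o h i (cellpt o h xi i p).
Proof.
move=> gl h0; rewrite /cell/= in_itv/= -(cellpt0 _ _ _ gl) -(cellpt_max _ _ _ gl).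
by rewrite !cellpt_le// -ltnS.
Qed.

(** For [s = K] the division in [globpt] returns the other name
    [(i + 1, 0)] of the node, which designates the same point. *)
Lemma globpt_node_index (R : realType) (K N : nat) (o h : R) (xi : 'I_K.+1 -> R)
  (i : nat) (s : 'I_K.+1) : (0 < K)%N -> gauss_lobatto xi -> (i < N)%N ->
  globpt o h xi (node_index N i s) = cellpt o h xi i s.
Proof.
move=> K0 gl iN; rewrite /globpt node_indexE//.
have := ltn_ord s; rewrite ltnS leq_eqVlt => /orP[/eqP sK|sK].
  have -> : s = ord_max by exact: ord_inj.
  rewrite cellpt_max// /= addnC -mulSn mulnK// modnMl -(cellpt0 _ _ _ gl).
  by congr cellpt; apply: ord_inj; rewrite inordK.
rewrite divnMDl// divn_small// addn0 modnMDl modn_small//.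
by rewrite inord_val.
Qed.

(** Partition of unity, at the level of the polynomials so that it can be
    differentiated: the sum minus 1 has degree at most [K] and vanishes at the
    [K + 1] nodes of the cell. *)
Lemma nodal_basis_poly (R : realType) (K N : nat) (o h : R) (xi : 'I_K.+1 -> R)
  (phi : 'I_(N * K).+1 -> R -> R) (i : nat) :
  (0 < K)%N -> 0 < h -> gauss_lobatto xi ->
  nodal_basis o h xi phi -> (i < N)%N ->
  exists P : 'I_(N * K).+1 -> {poly R},
    (forall b x, cell o h i x -> phi b x = (P b).[x]) /\ \sum_b P b = 1.
Proof.
move=> K0 h0 gl nb iN.
have /choice[P PP] : forall b, exists P : {poly R}, (size P <= K.+1)%N /\
    forall x, cell o h i x -> phi b x = P.[x].
  by move=> b; have [_ /(_ (Ordinal iN))[P ? ?] _] := nb b; exists P.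
exists P; split=> [b|]; first exact: (PP b).2.
apply/eqP; rewrite -subr_eq0; apply/eqP.
apply: (@roots_geq_poly_eq0 _ _ [seq cellpt o h xi i p | p <- enum 'I_K.+1]).
- apply/allP => _ /mapP[p _ ->]; rewrite /root hornerD horner_sum hornerN hornerC.
  rewrite (bigD1 (node_index N i p))//= big1; last first.
    move=> b bp; rewrite -(PP b).2; last exact: cellpt_in_cell.
    rewrite -(globpt_node_index (N := N) _ _ _ K0 gl iN); have [_ _ ->] := nb b.
    by rewrite (negbTE bp).
  rewrite -(PP _).2; last exact: cellpt_in_cell.
  rewrite -(globpt_node_index (N := N) _ _ _ K0 gl iN).
  have [_ _ ->] := nb (node_index N i p).
  by rewrite eqxx addr0 subrr.
- rewrite map_inj_uniq ?enum_uniq// => p q E; apply: ord_inj.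
  by apply/eqP; case: ltngtP => // /(cellpt_lt o i gl h0); rewrite E ltxx.
- rewrite size_map size_enum_ord (leq_trans (size_polyD _ _))// size_polyN size_poly1.
  rewrite geq_max (leq_trans (size_sum _ _ _))//.
  by apply/bigmax_leqP => b _; exact: (PP b).1.
Qed.

(** A derivative is local, hence the restriction to an open interval. *)
Lemma derive1_eq_poly (R : realType) (a b x : R) (f : R -> R) (P : {poly R}) :
  (forall z, a < z < b -> f z = P.[z]) -> a < x < b ->
  derive1 f x = P^`().[x].
Proof.
move=> fP /andP[ax xb]; rewrite derivE !derive1E; apply: near_eq_derive.
near=> z; apply: fP; apply/andP; split; near: z.
  exact: lt_nbhsr.
exact: lt_nbhsl.
Unshelve. all: by end_near. Qed.

(** A differentiation matrix kills constants.  The basis functions sum to 1 on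
    the domain, but [derive1] is additive only where they are differentiable,
    that is, inside the cells. *)
Lemma diff_mx_row_sum (R : realType) (K N : nat) (o h : R) (xi : 'I_K.+1 -> R)
  (phi : 'I_(N * K).+1 -> R -> R) :
  (0 < K)%N -> (0 < N)%N -> 0 < h -> gauss_lobatto xi ->
  nodal_basis o h xi phi ->
  forall a, \sum_b diff_mx o h phi a b = 0.
Proof.
move=> K0 N0 h0 gl nb a.
have cP i : exists P : 'I_(N * K).+1 -> {poly R}, (i < N)%N ->
    (forall b x, cell o h i x -> phi b x = (P b).[x]) /\ \sum_b P b = 1.
  have [iN|] := ltnP i N; last by exists (fun=> 0).
  by have [P ?] := nodal_basis_poly K0 h0 gl nb iN; exists P.
have /choice[P PP] := cP.
have phiE i b x : (i < N)%N -> gridpt o h i < x < gridpt o h i.+1 ->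
    phi b x = (P i b).[x].
  move=> iN /andP[ix xi1]; apply: (PP i iN).1.
  by rewrite /cell/= in_itv/= !ltW.
have dphiE i b x : (i < N)%N -> gridpt o h i < x < gridpt o h i.+1 ->
    derive1 (phi b) x = (P i b)^`().[x].
  by move=> iN; apply: derive1_eq_poly => z; exact: phiE.
under eq_bigr do rewrite mxE.
rewrite -Rintegral_sum.
- apply: Rintegral_zero_off_grid => // i x iN xI.
  rewrite -mulr_sumr; under eq_bigr do rewrite (dphiE i)//.
  have dP : \sum_b (P i b)^`() = 0 by rewrite -linear_sum/= (PP i iN).2 -polyC1 derivC.
  by rewrite -horner_sum dP horner0 mulr0.
- by rewrite domainE.
- move=> b.
  apply: (@integrable_piecewise_poly _ _ _ _ _ (fun i => P i a * (P i b)^`())) => //.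
  by move=> i x iN xI; rewrite hornerM (phiE i)// (dphiE i).
Qed.

Lemma integrable_nodal_basis (R : realType) (K N : nat) (o h : R) (xi : 'I_K.+1 -> R)
  (phi : 'I_(N * K).+1 -> R -> R) (b : 'I_(N * K).+1) :
  (0 < N)%N -> 0 < h -> nodal_basis o h xi phi ->
  lebesgue_measure.-integrable (domain N o h) (EFin \o phi b).
Proof.
move=> N0 h0 nb; have [cphi _ _] := nb b; move: cphi; rewrite domainE// => cphi.
by apply: continuous_compact_integrable => //; exact: segment_compact.
Qed.

(** * Integrators and the global flux *)

(** The integrator matrix computes primitives: linearity of the integral. *)
Lemma integrator_mx_sum (R : realType) (K N : nat) (o h : R) (xi : 'I_K.+1 -> R)
  (phi : 'I_(N * K).+1 -> R -> R) (w : 'I_(N * K).+1 -> R)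
  (i : nat) (s : 'I_K.+1) :
  (0 < K)%N -> (0 < N)%N -> 0 < h -> gauss_lobatto xi ->
  nodal_basis o h xi phi -> (i < N)%N ->
  \sum_b w b * integrator_mx o h xi phi (node_index N i s) b =
  (\int[lebesgue_measure]_(x in `[gridpt o h 0, cellpt o h xi i s])
     \sum_b w b * phi b x)%R.
Proof.
move=> K0 N0 h0 gl nb iN.
have sub : (`[gridpt o h 0, cellpt o h xi i s] `<=` domain N o h)%classic.
  rewrite domainE//; apply: subset_itvl; rewrite bnd_simp.
  have := @cellpt_in_cell _ _ o h xi i s gl h0.
  rewrite /cell/= in_itv/= => /andP[_ /le_trans]; apply.
  exact: gridpt_le.
have iphi b : lebesgue_measure.-integrable `[gridpt o h 0, cellpt o h xi i s]
    (EFin \o phi b).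
  apply: (integrableS _ _ _ (integrable_nodal_basis b N0 h0 nb)) => //.
  by rewrite domainE.
rewrite Rintegral_sum//; last first.
  move=> b; have -> : EFin \o (fun x => w b * phi b x) =
      (fun x => ((w b)%:E * (EFin \o phi b) x)%E) by apply/funext.
  exact: integrableZl.
apply: eq_bigr => b _; rewrite RintegralZl//; congr (_ * _).
rewrite !mxE globpt_node_index//; apply: eq_Rintegral => x _.
rewrite /interp (bigD1 b)//= mxE !eqxx mul1r big1 ?addr0// => c cb.
by rewrite mxE (negbTE cb) mul0r.
Qed.

(** A difference of primitives is an integral over the part of the cell between
    the two nodes. *)
Lemma integrator_mx_sumB (R : realType) (K N : nat) (o h : R) (xi : 'I_K.+1 -> R)
  (phi : 'I_(N * K).+1 -> R -> R) (w : 'I_(N * K).+1 -> R)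
  (i : nat) (s : 'I_K.+1) :
  (0 < K)%N -> (0 < N)%N -> 0 < h -> gauss_lobatto xi ->
  nodal_basis o h xi phi -> (i < N)%N ->
  (\int[lebesgue_measure]_(x in `[cellpt o h xi i ord0, cellpt o h xi i s])
     \sum_b w b * phi b x)%R =
  \sum_b w b * integrator_mx o h xi phi (node_index N i s) b -
  \sum_b w b * integrator_mx o h xi phi (node_index N i ord0) b.
Proof.
move=> K0 N0 h0 gl nb iN; rewrite !integrator_mx_sum//.
have iw : lebesgue_measure.-integrable (domain N o h)
    (EFin \o (fun x => \sum_b w b * phi b x)).
  have -> : EFin \o (fun x => \sum_b w b * phi b x) =
      (fun x => \sum_b (w b)%:E * (EFin \o phi b) x)%E.
    by apply/funext => x /=; rewrite -sumEFin.
  have mD : measurable (domain N o h) by rewrite domainE.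
  apply: integrable_sum => // b _; apply: integrableZl => //.
  exact: integrable_nodal_basis nb.
have l0 : gridpt o h 0 <= cellpt o h xi i ord0 by rewrite cellpt0// gridpt_le.
have ls : cellpt o h xi i ord0 <= cellpt o h xi i s by exact: cellpt_le.
have lN : cellpt o h xi i s <= gridpt o h N.
  rewrite (@le_trans _ _ (gridpt o h i.+1)) ?gridpt_le//.
  by rewrite -(cellpt_max _ _ _ gl) cellpt_le// -ltnS.
have sub (I : set R) : measurable I -> (I `<=` domain N o h)%classic ->
    lebesgue_measure.-integrable I (EFin \o (fun x => \sum_b w b * phi b x)).
  by move=> mI ID; apply: (integrableS _ _ _ iw) => //; rewrite domainE.
rewrite Rintegral_itvB ?bnd_simp//.
- rewrite Rintegral_itv_obnd_cbnd//; apply: sub => //.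
  by rewrite domainE//; apply: subset_itv; rewrite bnd_simp.
- by apply: sub => //; rewrite domainE//; apply: subset_itvl; rewrite bnd_simp.
Qed.

(** The interpolant takes the prescribed value at each node, also when the node
    is given its second local name. *)
Lemma nodal_basis_sum (R : realType) (K N : nat) (o h : R) (xi : 'I_K.+1 -> R)
  (phi : 'I_(N * K).+1 -> R -> R) (w : 'I_(N * K).+1 -> R)
  (i : nat) (s : 'I_K.+1) :
  (0 < K)%N -> gauss_lobatto xi ->
  nodal_basis o h xi phi -> (i < N)%N ->
  \sum_a w a * phi a (cellpt o h xi i s) = w (node_index N i s).
Proof.
move=> K0 gl nb iN.
have E a : phi a (cellpt o h xi i s) = (a == node_index N i s)%:R.
  by rewrite -(globpt_node_index (N := N) _ _ _ K0 gl iN); have [_ _ ->] := nb a.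
rewrite (bigD1 (node_index N i s))//= E eqxx mulr1 big1 ?addr0// => a an.
by rewrite E (negbTE an) mulr0.
Qed.

(** [I_y u + I_x v]: its mixed derivative is formally the divergence. *)
Definition global_flux (R : realType) (K Nx Ny : nat) (x0 y0 dx dy : R)
  (xi : 'I_K.+1 -> R)
  (phix : 'I_(Nx * K).+1 -> R -> R) (phiy : 'I_(Ny * K).+1 -> R -> R)
  (u v : 'M[R]_((Nx * K).+1, (Ny * K).+1)) : 'M[R]_((Nx * K).+1, (Ny * K).+1) :=
  u *m (integrator_mx y0 dy xi phiy)^T + integrator_mx x0 dx xi phix *m v.

Lemma gf_div_global_flux (R : realType) (K Nx Ny : nat) (x0 y0 dx dy : R)
  (xi : 'I_K.+1 -> R)
  (phix : 'I_(Nx * K).+1 -> R -> R) (phiy : 'I_(Ny * K).+1 -> R -> R)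
  (u v : 'M[R]_((Nx * K).+1, (Ny * K).+1)) :
  gf_div x0 y0 dx dy xi phix phiy u v =
  diff_mx x0 dx phix *m global_flux x0 y0 dx dy xi phix phiy u v
    *m (diff_mx y0 dy phiy)^T.
Proof.
by rewrite /gf_div !tensor_appE trmx_mul /global_flux mulmxDr mulmxDl !mulmxA.
Qed.

(** On a grid line [x = x_{i,t}] the interpolant of [u] reduces to the
    one-dimensional interpolant of a row of [u], so the first integral is a
    [y]-difference of primitives; the second one is treated alike in [x].  The
    two contributions are the mixed differences of the two terms of the flux. *)
Lemma subcell_div_global_flux (R : realType) (K Nx Ny : nat) (x0 y0 dx dy : R)
  (xi : 'I_K.+1 -> R)
  (phix : 'I_(Nx * K).+1 -> R -> R) (phiy : 'I_(Ny * K).+1 -> R -> R)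
  (u v : 'M[R]_((Nx * K).+1, (Ny * K).+1))
  (i : 'I_Nx) (s : 'I_K.+1) (j : 'I_Ny) (p : 'I_K.+1) :
  (0 < K)%N -> 0 < dx -> 0 < dy -> gauss_lobatto xi ->
  nodal_basis x0 dx xi phix -> nodal_basis y0 dy xi phiy ->
  let W := global_flux x0 y0 dx dy xi phix phiy u v in
  subcell_div x0 y0 dx dy xi phix phiy u v i s j p =
  (W (node_index Nx i s) (node_index Ny j p) -
   W (node_index Nx i s) (node_index Ny j ord0)) -
  (W (node_index Nx i ord0) (node_index Ny j p) -
   W (node_index Nx i ord0) (node_index Ny j ord0)).
Proof.
move=> K0 dx0 dy0 gl nbx nby W; rewrite /subcell_div.
have Nx0 : (0 < Nx)%N by exact: leq_trans (ltn_ord i).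
have Ny0 : (0 < Ny)%N by exact: leq_trans (ltn_ord j).
have uE t y : interp2 phix phiy u (cellpt x0 dx xi i t) y =
    \sum_b u (node_index Nx i t) b * phiy b y.
  rewrite /interp2 exchange_big; apply: eq_bigr => b _.
  rewrite -mulr_suml; congr (_ * _).
  exact: (nodal_basis_sum (u^~ b) t K0 gl nbx (ltn_ord i)).
have vE t x : interp2 phix phiy v x (cellpt y0 dy xi j t) =
    \sum_a v a (node_index Ny j t) * phix a x.
  apply: eq_bigr => a _.
  rewrite -(nodal_basis_sum (v a) t K0 gl nby (ltn_ord j)) mulr_suml.
  by apply: eq_bigr => b _; rewrite mulrAC.
have -> : (\int[lebesgue_measure]_(y in
        `[cellpt y0 dy xi j ord0, cellpt y0 dy xi j p])
      (interp2 phix phiy u (cellpt x0 dx xi i s) y -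
       interp2 phix phiy u (cellpt x0 dx xi i ord0) y))%R =
    (\int[lebesgue_measure]_(y in
        `[cellpt y0 dy xi j ord0, cellpt y0 dy xi j p])
      \sum_b (u (node_index Nx i s) b - u (node_index Nx i ord0) b) * phiy b y)%R.
  apply: eq_Rintegral => y _; rewrite !uE -sumrB.
  by apply: eq_bigr => b _; rewrite mulrBl.
have -> : (\int[lebesgue_measure]_(x in
        `[cellpt x0 dx xi i ord0, cellpt x0 dx xi i s])
      (interp2 phix phiy v x (cellpt y0 dy xi j p) -
       interp2 phix phiy v x (cellpt y0 dy xi j ord0)))%R =
    (\int[lebesgue_measure]_(x in
        `[cellpt x0 dx xi i ord0, cellpt x0 dx xi i s])
      \sum_a (v a (node_index Ny j p) - v a (node_index Ny j ord0)) * phix a x)%R.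
  apply: eq_Rintegral => x _; rewrite !vE -sumrB.
  by apply: eq_bigr => a _; rewrite mulrBl.
rewrite !integrator_mx_sumB//.
have IyE a b : \sum_c u a c * integrator_mx y0 dy xi phiy b c =
    (u *m (integrator_mx y0 dy xi phiy)^T) a b.
  by rewrite [RHS]mxE; apply: eq_bigr => c _; rewrite [in RHS]mxE.
have IxE a b : \sum_c v c b * integrator_mx x0 dx xi phix a c =
    (integrator_mx x0 dx xi phix *m v) a b.
  by rewrite [RHS]mxE; apply: eq_bigr => c _; rewrite mulrC.
have sumBl n (f g k : 'I_n -> R) :
    \sum_c (f c - g c) * k c = \sum_c f c * k c - \sum_c g c * k c.
  by rewrite -sumrB; apply: eq_bigr => c _; rewrite mulrBl.
rewrite !sumBl !IyE !IxE /W /global_flux.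
move: (u *m _) (_ *m v) => U V; rewrite !mxE.
ring.
Qed.

Theorem proposition4p2 (R : realType) (K Nx Ny : nat) (x0 y0 dx dy : R)
  (xi : 'I_K.+1 -> R)
  (phix : 'I_(Nx * K).+1 -> R -> R) (phiy : 'I_(Ny * K).+1 -> R -> R)
  (u v : 'M[R]_((Nx * K).+1, (Ny * K).+1))
  (hK : (1 <= K)%N) (hNx : (1 <= Nx)%N) (hNy : (1 <= Ny)%N)
  (hdx : 0 < dx) (hdy : 0 < dy)
  (hxi : gauss_lobatto xi)
  (hphix : nodal_basis x0 dx xi phix)
  (hphiy : nodal_basis y0 dy xi phiy)
  (hPhi : forall (i : 'I_Nx) (j : 'I_Ny) (s p : 'I_K.+1),
     subcell_div x0 y0 dx dy xi phix phiy u v i s j p = 0) :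
  gf_div x0 y0 dx dy xi phix phiy u v = 0.
Proof.
rewrite gf_div_global_flux; apply: mul_split_mx0.
- exact: diff_mx_row_sum hphix.
- exact: diff_mx_row_sum hphiy.
- apply: mixed_diff_split => // i j s p iN jN; apply/eqP; rewrite -subr_eq0.
  have := hPhi (Ordinal iN) (Ordinal jN) s p.
  by rewrite subcell_div_global_flux//= => ->.
Qed.
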